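(* Let $r, \beta$ be integers with $1 \leq \beta \leq r$ and $\beta \mid r$, let $n = \frac{(r+\beta)(r+2)}{2}$, and let $k$ be an integer with $1 \leq k \leq \frac{rn}{r+2}$. Let $b = \frac{2n}{r+2} = r+\beta$ and define integers $e_b, \ldots, e_1$ by $$e_b = n, \qquad e_{m-1} = e_m - \left\lceil \frac{2e_m}{m} \right\rceil + (r+1), \quad 2 \leq m \leq b,$$ with the convention $e_0 = 0$. Let $\ell$ be the unique integer with $0 \le \ell \le b-1$ such that $e_\ell < k+\ell < e_{\ell+1}$. Then for every prime power $q > k n^k$ there exists an $[n,k]$ linear code $\mathcal{C}$ over $\mathbb{F}_q$ that is locally $2$-reconstructible with locality $r$ and whose minimum distance is $$d_{\min}(\mathcal{C}) = n+1-(k+\ell).$$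
   Context: An $[n,k]$ code is a $k$-dimensional linear subspace of $\mathbb{F}_q^n$; $\mathcal{C}^\perp$ is its dual; $\mathrm{supp}(\mathbf{c})$ is the set of nonzero coordinates of $\mathbf{c}$. Locally $2$-reconstructible: a local parity is a codeword $\mathbf{h}\in \mathcal{C}^\perp$ with $|\mathrm{supp}(\mathbf{h})| \le r+1$; it covers coordinate $i$ if $i \in \mathrm{supp}(\mathbf{h})$. The code $\mathcal{C}$ is locally $2$-reconstructible with locality $r$ if any pair of erased code symbols can be recovered by a sequence of two local parity-check computations; that is, for every pair of distinct coordinates, the pair can be ordered as $(i,j)$ so that there is a local parity covering $i$ but not $j$ (used to recover $c_i$ first), and a local parity covering $j$ (used to recover $c_j$ next; it is allowed to also cover $i$). *)

(* Defs.v *)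
From HB Require Import structures.
From mathcomp Require Import all_boot all_order all_algebra.

Set Implicit Arguments.
Unset Strict Implicit.
Unset Printing Implicit Defensive.

Import Order.TTheory GRing.Theory Num.Theory.
Local Open Scope ring_scope.

(* An [n, k] code over F is a C : {vspace 'rV[F]_n} with \dim C = k. *)

Definition word_supp (F : finFieldType) (n : nat) (c : 'rV[F]_n) : {set 'I_n} :=
  [set i | c 0 i != 0].

Definition dual_code (F : finFieldType) (n : nat) (C : {vspace 'rV[F]_n}) :
    {set 'rV[F]_n} :=
  [set h : 'rV[F]_n | [forall c : 'rV[F]_n,
    (c \in C) ==> (\sum_i h 0 i * c 0 i == 0)]].

Definition hamming_dist (F : finFieldType) (n : nat) (x y : 'rV[F]_n) : nat :=
  #|[set i | x 0 i != y 0 i]|.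

(* Hamming distances in F^n never exceed n, so the default value n only matters
   for the zero code, which has no pair of distinct codewords. *)
Definition min_dist (F : finFieldType) (n : nat) (C : {vspace 'rV[F]_n}) : nat :=
  \big[minn/n]_(p : 'rV[F]_n * 'rV[F]_n
                | [&& p.1 \in C, p.2 \in C & p.1 != p.2])
    hamming_dist p.1 p.2.

Definition local_parity (F : finFieldType) (n r : nat) (C : {vspace 'rV[F]_n})
    (h : 'rV[F]_n) : Prop :=
  h \in dual_code C /\ (#|word_supp h| <= r.+1)%N.

(* The erased pair {i, j} can be repaired by recovering c_i first, without
   knowledge of c_j, and then c_j, possibly using c_i. *)
Definition repairs_in_order (F : finFieldType) (n r : nat)
    (C : {vspace 'rV[F]_n}) (i j : 'I_n) : Prop :=
  (exists h, [/\ local_parity r C h, i \in word_supp h & j \notin word_supp h])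
  /\ (exists h, local_parity r C h /\ j \in word_supp h).

Definition locally_2_reconstructible (F : finFieldType) (n r : nat)
    (C : {vspace 'rV[F]_n}) : Prop :=
  forall i j : 'I_n, i != j ->
    repairs_in_order r C i j \/ repairs_in_order r C j i.

(* Main.v *)
Require Import Defs.
From HB Require Import structures.
From mathcomp Require Import all_boot all_order all_algebra.
From mathcomp Require Import zify ring mxabelem.

Set Implicit Arguments.
Unset Strict Implicit.
Unset Printing Implicit Defensive.

Import Order.TTheory GRing.Theory Num.Theory.
Local Open Scope ring_scope.
Local Open Scope nat_scope.

(** Let R = r / beta + 1 and let G be the complete multipartite graph on
    b = r + beta vertices with R classes of size beta; it is r-regular with
    b r / 2 edges. The n coordinates are the edges of G together with one pendant
    edge at each vertex, and the parities are the stars of the vertices, so a word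
    orthogonal to all parities is a circulation of G with an added apex. A space of
    combinations of parities supported in S attaches to every vertex a vector of
    coefficients, constant along the edges outside S (and 0 at the apex); counting
    edges inside the level sets (a Turan-type bound) shows that a j-dimensional
    such space needs at least e_j coordinates in S, with equality for the stars of
    the last j vertices.
    Hence every set of k + l coordinates has rank at least k on the
    circulations, and a subspace of dimension k meeting trivially the fewer than
    q subspaces that vanish on k independent coordinates keeps this rank. *)

(** * Degrees and edge counts of the complete multipartite graph *)

(* Vertex i lies in class i mod R: back_deg R i is the number of its neighbours
   below i, and turan R m the number of edges on the vertices below m. *)
Definition back_deg (R i : nat) : nat := i - i %/ R.

Definition turan (R m : nat) : nat := \sum_(i < m) back_deg R i.

Definition adj (R u v : nat) : bool := u %% R != v %% R.

Lemma adjC R u v : adj R u v = adj R v u.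
Proof. by rewrite /adj eq_sym. Qed.

Lemma turanS R m : turan R m.+1 = turan R m + back_deg R m.
Proof. by rewrite /turan big_ord_recr. Qed.

Lemma turan0 R : turan R 0 = 0.
Proof. by rewrite /turan big_ord0. Qed.

Lemma leq_turan R m n : m <= n -> turan R m <= turan R n.
Proof.
elim: n => [|n IHn]; first by rewrite leqn0 => /eqP->.
rewrite leq_eqVlt => /orP[/eqP->//|]; rewrite ltnS => /IHn le_mn.
by rewrite turanS (leq_trans le_mn) ?leq_addr.
Qed.

Lemma back_degS R i : 0 < R ->
  back_deg R i <= back_deg R i.+1 <= (back_deg R i).+1.
Proof.
move=> R_gt0; rewrite /back_deg divnS //.
have := leq_div i R; case: (_ %| _) => /=; lia.
Qed.

Lemma leq_back_deg R i j : 0 < R -> i <= j -> back_deg R i <= back_deg R j.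
Proof.
move=> R_gt0; elim: j => [|j IHj]; first by rewrite leqn0 => /eqP->.
rewrite leq_eqVlt => /orP[/eqP->//|]; rewrite ltnS => /IHj le_ij.
by apply: (leq_trans le_ij); case/andP: (back_degS j R_gt0).
Qed.

(** The quotient is the ceiling of (m - c) / R; passing from [m] to [m.+1], it grows exactly when
    [m] has residue [c]. *)
Lemma count_residue R c m : c < R ->
  \sum_(u < m) (u %% R == c) = (m + (R.-1 - c)) %/ R.
Proof.
move=> lt_cR; have R_gt0 : 0 < R by case: R lt_cR.
elim: m => [|m IHm]; first by rewrite big_ord0 divn_small //; lia.
rewrite big_ord_recr /= IHm addSn divnS // addnC; congr (nat_of_bool _ + _).
rewrite {1 2}(divn_eq m R) modnMDl modn_mod.
rewrite -addnS -addnA dvdn_addr ?dvdn_mull //.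
have := ltn_pmod m R_gt0; move: (m %% R) => d lt_dR.
have -> : d + (R.-1 - c).+1 = d + (R - c) by lia.
case: (ltngtP d c) => [lt_dc|lt_cd|->].
- by rewrite gtnNdvd //; lia.
- have -> : d + (R - c) = (d - c) + R by lia.
  by rewrite dvdn_addl // gtnNdvd //; lia.
- by rewrite subnKC ?dvdnn // ltnW.
Qed.

Lemma sum_back_adj R v : 0 < R -> \sum_(u < v) adj R u v = back_deg R v.
Proof.
move=> R_gt0; rewrite /back_deg; apply/eqP.
have E : \sum_(u < v) (u %% R == v %% R) = v %/ R.
  rewrite count_residue ?ltn_pmod //.
  have lt_vR := ltn_pmod v R_gt0.
  have E : v %% R + (R.-1 - v %% R) = R.-1 by apply: subnKC; case: R R_gt0 lt_vR.
  by rewrite {1}(divn_eq v R) -addnA E divnMDl // [R.-1 %/ R]divn_small ?addn0 ?ltn_predL.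
rewrite -(eqn_add2r (v %/ R)) subnK ?leq_div // -{1}E -big_split /=.
rewrite (eq_bigr (fun=> 1)) ?sum1_card ?card_ord // => u _.
by rewrite /adj; case: (_ == _).
Qed.

Lemma count_residue_all R s c : c < R ->
  \sum_(u < s * R) (u %% R == c) = s.
Proof.
move=> lt_cR; rewrite count_residue // divnMDl ?divn_small ?addn0 //; lia.
Qed.

(** Degree sum on the first m + 1 vertices: vertex [m] has least degree [back_deg R m], and the
    vertices in the R - 1 - (m mod R) smaller classes, of size m / R, have degree one more. This
    excess is the rounding error in the recursion for e. *)
Lemma double_turan R m : 0 < R ->
  2 * turan R m.+1 =
    m.+1 * back_deg R m + (m %/ R) * (R.-1 - m %% R).
Proof.
move=> R_gt0; elim: m => [|m IHm].
  by rewrite turanS turan0 /back_deg div0n sub0n muln0 mul0n.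
rewrite turanS mulnDr IHm /back_deg.
have := divn_eq m R; have := ltn_pmod m R_gt0.
rewrite divnS // modnS.
have dvdE : (R %| m.+1) = (m %% R == R.-1).
  rewrite {1}(divn_eq m R) -addnS dvdn_addr ?dvdn_mull //.
  have := ltn_pmod m R_gt0; move: (m %% R) => d lt_dR.
  apply/idP/eqP => [/dvdn_leq|->]; [lia | by rewrite prednK].
rewrite dvdE; move: (m %/ R) (m %% R) => a c lt_cR ->.
case: eqP => [->|/eqP ne_c] /=.
- have le1: a <= a * R by rewrite leq_pmulr.
  have le2: a + a * 0 <= a * R + R.-1 by lia.
  case: R R_gt0 {dvdE lt_cR IHm} le1 le2 => //= R _ le1 le2; nia.
- have le1: a <= a * R by rewrite leq_pmulr.
  have [x xE] : exists x, R.-1 - c = x.+1 by exists (R.-1 - c).-1; lia.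
  have -> : R.-1 - c.+1 = x by lia.
  have [D DE] : exists D, a * R + c = D + a by exists (a * R + c - a); lia.
  rewrite xE DE add0n addnK.
  have -> : (D + a).+1 - a = D.+1 by lia.
  by rewrite !mulnS !mulSn; lia.
Qed.

(** Reversing the vertex order permutes the classes, so the second term counts the neighbours of [j]
    above [j], and the sum is the full degree. *)
Lemma back_deg_compl R s j : j < s * R ->
  back_deg R j + back_deg R (s * R - j.+1) = s * R - s.
Proof.
move=> lt_j; have R_gt0 : 0 < R by case: R lt_j; rewrite ?muln0.
rewrite /back_deg.
have := divn_eq j R; have := ltn_pmod j R_gt0.
have lt_a : j %/ R < s by rewrite ltn_divLR.
move: (j %/ R) (j %% R) lt_a => a c lt_as lt_cR ej.
have -> : s * R - j.+1 = (s - a.+1) * R + (R.-1 - c).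
  rewrite ej mulnBl mulSn; have : a.+1 * R <= s * R by rewrite leq_mul2r lt_as orbT.
  rewrite mulSn; lia.
rewrite divnMDl // divn_small ?addn0; last lia.
rewrite ej; have : a <= a * R by rewrite leq_pmulr.
have : s - a.+1 <= (s - a.+1) * R by rewrite leq_pmulr.
have : (s - a.+1) * R + a.+1 * R = s * R by rewrite -mulnDl subnK.
rewrite mulSn; lia.
Qed.

(** The last [j] vertices have degree sum j (s R - s), which counts twice the edges among them; by
    reversal there are [turan R j] of these. The case j = s R gives the total number of edges. *)
Lemma turan_compl R s j : j <= s * R ->
  turan R (s * R) + turan R j = j * (s * R - s) + turan R (s * R - j).
Proof.
elim: j => [|j IHj] le_j; first by rewrite turan0 subn0 mul0n addn0.
rewrite turanS addnA IHj 1?ltnW // mulSn.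
have -> : s * R - j = (s * R - j.+1).+1 by lia.
by rewrite turanS -(back_deg_compl le_j); lia.
Qed.

(** * A Turan-type bound for edges inside level sets *)

(** Otherwise each of the [R] classes meets [B] in at most (|B| - 1) / R vertices, rounded down,
    which leaves at most |B| - 1 vertices in all. *)
Lemma exists_low_degree R b (B : {set 'I_b}) : 0 < R -> B != set0 ->
  exists2 v, v \in B & \sum_(w in B) adj R v w <= back_deg R #|B|.-1.
Proof.
move=> R_gt0 B_n0; have B_gt0 : 0 < #|B| by rewrite card_gt0.
case: (boolP [exists v in B, \sum_(w in B) adj R v w <= back_deg R #|B|.-1]).
  by case/existsP=> v /andP[vB le_v]; exists v.
rewrite negb_exists => /forallP hdeg; exfalso.
have few (v : 'I_b) : v \in B -> \sum_(w in B) (w %% R == v %% R) <= #|B|.-1 %/ R.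
  move=> vB; have := hdeg v; rewrite vB /= -ltnNge /back_deg => lt_v.
  have := leq_div #|B|.-1 R.
  have : \sum_(w in B) adj R v w + \sum_(w in B) (w %% R == v %% R) = #|B|.
    rewrite -big_split -sum1_card; apply: eq_bigr => w _ /=.
    by rewrite /adj eq_sym; case: (_ == _).
  move: lt_v B_gt0; set x := \sum_(w in B) adj R v w.
  set y := \sum_(w in B) (w %% R == v %% R).
  by move: (#|B|.-1 %/ R) x y #|B| => q x y m; lia.
case: R R_gt0 {hdeg} few => // R _ few.
have : #|B| <= \sum_(c < R.+1) #|B|.-1 %/ R.+1.
  rewrite -[leqLHS]sum1_card [leqLHS](partition_big (fun w : 'I_b => inord (w %% R.+1) : 'I_R.+1) predT) //=.
  apply: leq_sum => c _.
  case: (pickP [pred v in B | v %% R.+1 == c]) => [v /andP[vB /eqP vc] | none].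
    apply: leq_trans (few v vB); rewrite vc big_mkcondr /=.
    by apply: leq_sum => w _; rewrite -val_eqE /= inordK ?ltn_pmod //; case: eqP.
  rewrite big_pred0 // => w; have := none w.
  by rewrite /= -val_eqE /= inordK ?ltn_pmod.
rewrite sum_nat_const card_ord mulnC; have := leq_trunc_div #|B|.-1 R.+1; lia.
Qed.

(* The edge (u, w) joins equal values of phi, where a loop is read as the edge to
   an apex with value x0. *)
Definition within (R b : nat) (X : finType) (x0 : X) (phi : 'I_b -> X)
    (u w : 'I_b) : bool :=
  (u <= w) && (if u == w then phi u == x0 else adj R u w && (phi u == phi w)).

(* Peel off a singleton class if there is one, and otherwise a vertex of least
   degree inside its own class. *)
Lemma sum_within R b (X : finType) (x0 : X) (phi : 'I_b -> X) (A : {set 'I_b}) :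
  0 < R -> let d := #|A| - #|(phi @: A) :\ x0| in
  \sum_(u in A) \sum_(w in A) within R x0 phi u w <= turan R d + d.
Proof.
move=> R_gt0 /=; have [s] := ubnP #|A|; elim: s A => // s IHs A /ltnSE leAs.
case: (set_0Vmem A) => [->|[v0 v0A]]; first by rewrite big_set0.
(* Removing [v] loses only its edges inside its own level set, and its apex edge when [phi v] is
   [x0]. *)
have peel v : v \in A -> \sum_(u in A) \sum_(w in A) within R x0 phi u w
  <= \sum_(u in A :\ v) \sum_(w in A :\ v) within R x0 phi u w
     + (\sum_(w in [set u in A | phi u == phi v]) adj R v w + (phi v == x0)).
  move=> vA; rewrite (big_setD1 v vA) /= (big_setD1 v vA) /=.
  have -> : within R x0 phi v v = (phi v == x0) by rewrite /within leqnn eqxx.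
  rewrite [X in _ + X](eq_bigr (fun u => within R x0 phi u v +
     \sum_(w in A :\ v) within R x0 phi u w)); last first.
    by move=> u _; rewrite (big_setD1 v vA).
  have regroup a c d e x : c + d <= x -> (a + c) + (d + e) <= e + (x + a) by lia.
  rewrite big_split /=; apply: regroup.
  have -> : \sum_(w in [set u in A | phi u == phi v]) adj R v w =
            \sum_(w in A) ((phi w == phi v) && adj R v w).
    rewrite [RHS](bigID (fun w => phi w == phi v)) /= [X in _ = _ + X]big1; last first.
      by move=> w /andP[_ /negPf->].
    rewrite addn0; apply: eq_big => [w|w]; first by rewrite inE.
    by rewrite inE => /andP[_ ->].
  rewrite -big_split /= [leqRHS](big_setD1 v vA) /=; apply: leq_trans (leq_addl _ _).
  apply: leq_sum => w; rewrite !inE => /andP[/negPf w_v _].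
  rewrite /within w_v [v == w]eq_sym w_v [adj R w v]adjC [phi v == _]eq_sym.
  have : ~~ ((v <= w) && (w <= v)).
    by apply/negP => /anti_leq /val_inj E; rewrite E eqxx in w_v.
  by case: (v <= w) (w <= v) (adj R v w) (phi w == phi v) => [] [] [] [].
have [p0 p0E] : {p | p = #|(phi @: A) :\ x0|} by exists #|(phi @: A) :\ x0|.
rewrite -p0E.
have IH v d : v \in A -> #|A|.-1 - #|phi @: (A :\ v) :\ x0| <= d ->
    \sum_(u in A :\ v) \sum_(w in A :\ v) within R x0 phi u w <= turan R d + d.
  move=> vA le_d; have := cardsD1 v A; rewrite vA => cA.
  have AE : #|A|.-1 = #|A :\ v| by lia.
  have lt_s : #|A :\ v| < s by lia.
  by rewrite AE in le_d; apply: leq_trans (IHs _ lt_s) _; rewrite leq_add ?leq_turan.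
case: (boolP [exists v in A, (phi v != x0) &&
         ([set u in A | phi u == phi v] == [set v])]).
  case/existsP=> v /and3P[vA vx0 /eqP clv].
  (* A singleton class off the apex carries no edge. Removing it lowers |A| by one and the number of
     values by at most one, so d does not grow. *)
  apply: leq_trans (peel v vA) _; rewrite clv big_set1 /adj eqxx (negPf vx0) !addn0.
  apply: (IH v _ vA).
  have le_p0 : p0 <= #|phi @: (A :\ v) :\ x0|.+1.
    rewrite p0E -[in leqLHS](setD1K vA) imsetU1 setDUl.
    apply: leq_trans (leq_card_setU _ _) _; rewrite -add1n leq_add //.
    by rewrite (leq_trans (subset_leq_card (subsetDl _ _))) ?cards1.
  have pred_sub a p q : p <= q.+1 -> a.-1 - q <= a - p by lia.
  exact: pred_sub le_p0.
rewrite negb_exists => /forallP no_single.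
set B := [set u in A | phi u == phi v0].
have v0B : v0 \in B by rewrite inE v0A eqxx.
have [|v vB le_v] := @exists_low_degree R b B R_gt0.
  by apply/set0Pn; exists v0.
move: (vB); rewrite inE => /andP[vA /eqP vv0].
have BE : [set u in A | phi u == phi v] = B by rewrite vv0.
(* No value other than [x0] is lost with [v], because its level set is not a singleton. *)
have imE : p0 <= #|phi @: (A :\ v) :\ x0|.
  rewrite p0E; apply/subset_leq_card/subsetP => x; rewrite !inE => /andP[xx0 /imsetP[u uA xE]].
  rewrite xx0 /=; case: (eqVneq u v) => [uv|uv]; last first.
    by rewrite xE imset_f // !inE uv.
  have := no_single v; rewrite vA -uv -xE xx0 /= => /eqP/setP ne.
  apply/imsetP; case: (pickP [pred w in A :\ v | phi w == x]) => [w /andP[wA /eqP <-]|none].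
    by exists w; rewrite ?uv.
  exfalso; apply: ne => w; have := none w; rewrite !inE /= -uv.
  by case: (eqVneq w u) => [->|_ /= ->]; rewrite ?uA -?xE ?eqxx.
(* Values other than [x0] and [phi v] are all taken outside [B]; the boolean accounts for [phi v]
   itself. *)
have subE : p0 + #|B| <= #|A| + (phi v != x0).
  have : p0 <= #|phi @: (A :\: B)| + (phi v != x0).
    rewrite p0E; have cl x : x \in (phi @: A) :\ x0 -> x != phi v -> x \in phi @: (A :\: B).
      rewrite !inE => /andP[_ /imsetP[u uA xE]] xv; rewrite xE imset_f // !inE uA.
      by rewrite -vv0 -xE xv.
    case: (eqVneq (phi v) x0) => [vx0|_] /=.
      rewrite addn0; apply/subset_leq_card/subsetP => x xA; apply: cl => //.
      by rewrite vx0; move: xA; rewrite !inE => /andP[].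
    apply: (@leq_trans #|phi v |: phi @: (A :\: B)|); last first.
      by rewrite cardsU1 addnC leq_add2l; case: (_ \notin _).
    apply/subset_leq_card/subsetP => x /cl; rewrite in_setU1.
    by case: eqP => //= _; apply.
  have := leq_imset_card phi (A :\: B).
  have BA : B \subset A by apply/subsetP=> u; rewrite inE => /andP[].
  have := subset_leq_card BA; rewrite cardsD (setIidPr BA).
  have card_arith a b' p i t : b' <= a -> i <= a - b' -> p <= i + t -> p + b' <= a + t by lia.
  exact: card_arith.
have B_gt0 : 0 < #|B| by apply/card_gt0P; exists v0.
have B_gt1 : phi v != x0 -> 1 < #|B|.
  move=> vx0; have := no_single v; rewrite vA vx0 BE /= => nB.
  rewrite ltnNge; apply/negP => leB; case/negP: nB; rewrite eq_sym eqEcard sub1set vB.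
  by rewrite cards1.
apply: leq_trans (peel v vA) _; rewrite BE.
have [x dE] : exists x, #|A| - p0 = x.+1.
  have card_arith a b' p (t : bool) : 0 < b' -> (t -> 1 < b') -> p + b' <= a + t ->
    a - p = (a - p).-1.+1 by case: t => /= ? b_gt; rewrite ?[_ -> _]b_gt //; lia.
  by exists (#|A| - p0).-1; apply: card_arith B_gt0 B_gt1 subE.
rewrite dE turanS.
have le_d : #|A|.-1 - #|phi @: (A :\ v) :\ x0| <= x.
  have card_arith a p q : p <= q -> a - p = x.+1 -> a.-1 - q <= x by lia.
  exact: card_arith imE dE.
apply: leq_trans (leq_add (IH v x vA le_d) (leq_add le_v (leqnn _))) _ => //.
(* On the apex class, |B| - 1 is at most x and one apex edge is lost. Off it, |B| - 1 may reach x +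
   1, but there is no apex edge. Either way the loss is at most [back_deg R x] + 1, the growth of
   the bound from x to x + 1. *)
have le_B : #|B|.-1 <= x + (phi v != x0).
  have card_arith a b' p t : p + b' <= a + t -> a - p = x.+1 -> b'.-1 <= x + t by lia.
  exact: card_arith subE dE.
have [/andP[_ le_x]] := (back_degS x R_gt0, tt).
have := leq_back_deg R_gt0 le_B; case: (phi v == x0) => /=; rewrite ?addn0 ?addn1; lia.
Qed.
Local Open Scope ring_scope.

(** * Subspaces in general position over a finite field *)

Lemma mxrank_distinct_rows (F : finFieldType) m n (A : 'M[F]_(m, n)) :
  (\rank A <= #|[set row u A | u in setT] :\ 0%R|)%N.
Proof.
set X := _ :\ _.
have sAX : (A <= \matrix_(i < #|X|) (enum_val i : 'rV_n))%MS.
  apply/row_subP => u; have [->|nz_u] := eqVneq (row u A) 0; first exact: sub0mx.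
  have uX : row u A \in X by rewrite in_setD1 nz_u; apply/imsetP; exists u.
  have -> : row u A = row (enum_rank_in uX (row u A))
      (\matrix_(i < #|X|) (enum_val i : 'rV_n)).
    by rewrite rowK enum_rankK_in.
  exact: row_sub.
exact: leq_trans (mxrankS sAX) (rank_leq_row _).
Qed.

(** With q = |F|, each [Z i] has at most q^(rank W - 1) vectors, so fewer than q of them cannot
    cover the q^(rank W) vectors of [W]. *)
Lemma avoid_subspaces (F : finFieldType) n m (I : finType) (W : 'M[F]_(m, n))
    (Z : I -> 'M[F]_n) :
  (0 < #|I| < #|F|)%N -> (forall i, \rank (Z i) < \rank W)%N ->
  exists2 v : 'rV_n, (v <= W)%MS & forall i, ~~ (v <= Z i)%MS.
Proof.
case/andP=> I_gt0 ltIF ltZW; have [i0 _] := card_gt0P I_gt0.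
case: (boolP [exists v : 'rV[F]_n, (v <= W)%MS && [forall i, ~~ (v <= Z i)%MS]]).
  by case/existsP=> v /andP[vW /forallP vZ]; exists v.
rewrite negb_exists => /forallP hcov; exfalso.
have F_gt0 : (0 < #|F|)%N by apply: leq_ltn_trans ltIF.
have W_gt0 : (0 < \rank W)%N by apply: leq_ltn_trans (ltZW i0).
have : (#|rowg W| <= #|\bigcup_i rowg (Z i)|)%N.
  apply/subset_leq_card/subsetP => v; rewrite mem_rowg => vW.
  have := hcov v; rewrite vW /= negb_forall => /existsP[i].
  by rewrite negbK => vZ; apply/bigcupP; exists i; rewrite ?mem_rowg.
have : (#|\bigcup_i rowg (Z i)| <= \sum_i #|rowg (Z i)|)%N.
  elim/big_rec2: _ => [|i x y _ le_y]; first by rewrite cards0.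
  by apply: leq_trans (leq_card_setU _ _) _; rewrite leq_add2l.
have : (\sum_i #|rowg (Z i)| <= \sum_(i : I) #|F| ^ (\rank W).-1)%N.
  apply: leq_sum => i _; rewrite card_rowg leq_pexp2l //.
  by have := ltZW i; lia.
have : (\sum_(i : I) #|F| ^ (\rank W).-1 < #|F| ^ \rank W)%N.
  rewrite sum_nat_const -{2}(prednK W_gt0) expnS ltn_pmul2r //.
  by rewrite expn_gt0 F_gt0.
rewrite card_rowg => h1 h2 h3 h4.
by have := leq_ltn_trans (leq_trans h4 (leq_trans h3 h2)) h1; rewrite ltnn.
Qed.

(** Rows are added one at a time: the new row is chosen in [W] outside every sum of [Z i] and the
    span of the previous rows. *)
Lemma generic_subspace (F : finFieldType) n m k (I : finType) (W : 'M[F]_(m, n))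
    (Z : I -> 'M[F]_n) :
  (0 < #|I| < #|F|)%N -> (forall i, \rank (Z i) + k <= \rank W)%N ->
  exists2 C : 'M[F]_(k, n), (C <= W)%MS &
    forall i (x : 'rV_k), (x *m C <= Z i)%MS -> x = 0.
Proof.
move=> hI; elim: k => [|k IHk] hZ.
  by exists 0 => [|i x _]; [exact: sub0mx | apply/rowP => - []].
have [i|C sCW hC] := IHk; first by apply: leq_trans (hZ i); rewrite addnS.
have [i|v vW hv] := @avoid_subspaces F n m I W (fun i => C + Z i)%MS hI.
  apply: leq_ltn_trans (mxrank_adds_leqif _ _) _.
  by have := rank_leq_row C; have := hZ i; lia.
exists (col_mx v C) => [|i x]; first by rewrite -[k.+1]/(1 + k)%N col_mx_sub vW.
rewrite -[k.+1]/(1 + k)%N in x *.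
rewrite -[x]hsubmxK mul_row_col; set a := lsubmx x; set y := rsubmx x => sZ.
(* A nonzero coefficient of [v] would put [v] into C + Z i. *)
have a0 : a = 0.
  apply/rowP => j; rewrite ord1 [RHS]mxE; apply/eqP/negPn/negP => nz_a.
  case/negP: (hv i); rewrite -(eqmx_scale v nz_a) -mul_scalar_mx -mx11_scalar.
  rewrite -[_ *m v](addrK (y *m C)) addrC addmx_sub_adds //.
  by rewrite eqmx_opp submxMl.
by move: sZ; rewrite a0 mul0mx add0r => /hC->; rewrite row_mx0.
Qed.

(** * The parity matrix and the relations among its restricted rows *)

Lemma card_preim_le (b n : nat) (ends : 'I_n -> 'I_b * 'I_b)
    (Q : 'I_b -> 'I_b -> bool) :
  injective ends ->
  (#|[set i | Q (ends i).1 (ends i).2]| <= \sum_u \sum_w Q u w)%N.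
Proof.
move=> ends_inj; rewrite pair_big /= -(card_imset _ ends_inj).
rewrite -[leqRHS]big_mkcond /= sum1_card; apply/subset_leq_card/subsetP => p.
by case/imsetP=> i; rewrite !inE => Qi ->.
Qed.

(* Up to signs, row v is the star of v; the signs make the row space of this
   matrix a cut space, independently of the characteristic. *)
Definition parity_mx (F : finFieldType) (b n : nat)
    (ends : 'I_n -> 'I_b * 'I_b) : 'M[F]_(b, n) :=
  \matrix_(v, i) ((v == (ends i).1)%:R
     - ((v == (ends i).2) && ((ends i).1 != (ends i).2))%:R).

Lemma mul_parity_mxE (F : finFieldType) m b n (ends : 'I_n -> 'I_b * 'I_b)
    (A : 'M[F]_(m, b)) x i :
  (A *m parity_mx F ends) x i = A x (ends i).1
     - (if (ends i).1 == (ends i).2 then 0 else A x (ends i).2).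
Proof.
rewrite mxE; under eq_bigr do rewrite mxE mulrBr.
rewrite big_split /= sumrN (bigD1 (ends i).1) //= eqxx mulr1.
rewrite [X in _ + X - _]big1 ?addr0 => [|v /negPf->]; last by rewrite mulr0.
congr (_ - _); case: eqVneq => [_|ne].
  by rewrite big1 // => v _; rewrite andbF mulr0.
rewrite (bigD1 (ends i).2) //= eqxx mulr1 big1 ?addr0 // => v /negPf->.
by rewrite mulr0.
Qed.

(** The rows are the unit vectors at [T]: they span the words supported in [T], and multiplying by
    the transpose restricts to [T]. *)
Definition coord_mx (F : finFieldType) (n : nat) (T : {set 'I_n}) :
    'M[F]_(#|T|, n) := \matrix_(i, j) (enum_val i == j)%:R.

Lemma mul_tr_coord_mxE (F : finFieldType) m n (T : {set 'I_n}) (A : 'M[F]_(m, n)) x i :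
  (A *m (coord_mx F T)^T) x i = A x (enum_val i).
Proof.
rewrite mxE (bigD1 (enum_val i)) //= !mxE eqxx mulr1 big1 ?addr0 // => j /negPf ne.
by rewrite !mxE eq_sym ne mulr0.
Qed.

Lemma sub_coord_mx (F : finFieldType) n (T : {set 'I_n}) (w : 'rV[F]_n) :
  (forall i, i \notin T -> w 0 i = 0) -> (w <= coord_mx F T)%MS.
Proof.
move=> w0; apply/submxP; exists (w *m (coord_mx F T)^T); apply/rowP => j.
rewrite mxE; under eq_bigr do rewrite mul_tr_coord_mxE mxE.
have [jT|jT] := boolP (j \in T); last first.
  rewrite w0 // big1 // => i _; case: eqP => [E|_]; last by rewrite mulr0.
  by rewrite -E enum_valP in jT.
rewrite (bigD1 (enum_rank_in jT j)) //= enum_rankK_in // eqxx mulr1 big1 ?addr0 //.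
move=> i ne; case: eqP => [E|_]; last by rewrite mulr0.
by case/eqP: ne; rewrite -{2}E enum_valK_in.
Qed.

(** [K] lists the combinations of parities that vanish on [T], and [phi u] collects their
    coefficients at vertex [u]. Each edge in [T] joins equal values of [phi], or the value 0 to the
    apex, and rank [j] needs at least [j] distinct nonzero values, so [sum_within] applies. *)
Lemma card_uncovered_le (F : finFieldType) R b n (ends : 'I_n -> 'I_b * 'I_b)
    (T : {set 'I_n}) :
  (0 < R)%N -> injective ends ->
  (forall i, ((ends i).1 <= (ends i).2)%N &&
      (((ends i).1 == (ends i).2) || adj R (ends i).1 (ends i).2)) ->
  let j := \rank (kermx (parity_mx F ends *m (coord_mx F T)^T)) in
  (#|T| <= turan R (b - j) + (b - j))%N.
Proof.
move=> R_gt0 ends_inj ends_ok /=; set K := kermx _; set j := \rank K.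
pose phi (u : 'I_b) : 'rV[F]_b := row u K^T.
have phiE u x : phi u 0 x = K x u by rewrite 2!mxE.
have le_j : (j <= #|[set phi u | u in [set: 'I_b]] :\ 0%R|)%N.
  by rewrite /j -mxrank_tr mxrank_distinct_rows.
have K0 x i : i \in T -> (K *m parity_mx F ends) x i = 0.
  move=> iT; have := congr1 (fun M : 'M_(_, _) => M x (enum_rank_in iT i)) (mulmx_ker
    (parity_mx F ends *m (coord_mx F T)^T)).
  by rewrite mulmxA mul_tr_coord_mxE enum_rankK_in // => ->; rewrite mxE.
have leT : (#|T| <= #|[set i | within R 0%R phi (ends i).1 (ends i).2]|)%N.
  apply/subset_leq_card/subsetP => i iT; rewrite inE /within.
  have /andP[-> adj_i] := ends_ok i.
  case: eqVneq adj_i => [E _|ne /= ->] /=.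
    apply/eqP/rowP => x; rewrite phiE [RHS]mxE.
    by have := K0 x i iT; rewrite mul_parity_mxE -E eqxx subr0.
  apply/eqP/rowP => x; rewrite !phiE; apply/eqP; rewrite -subr_eq0.
  by have := K0 x i iT; rewrite mul_parity_mxE (negPf ne) => ->.
apply: leq_trans leT _; apply: leq_trans (card_preim_le _ ends_inj) _.
have := sum_within 0%R phi [set: 'I_b] R_gt0; rewrite /= cardsT card_ord => le_w.
apply: leq_trans (leq_trans _ le_w) _.
  by apply: eq_leq; apply: eq_big => [u|u _]; rewrite ?inE //; apply: eq_bigl => w; rewrite inE.
have le_d : (b - #|[set phi u | u in [set: 'I_b]] :\ 0%R| <= b - j)%N by rewrite leq_sub2l.
by rewrite leq_add ?leq_turan.
Qed.

(** * Circulations vanishing on a set of coordinates *)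

Definition vanish_mx (F : finFieldType) b n (H : 'M[F]_(b, n)) (S : {set 'I_n}) :
    'M[F]_n :=
  (kermx H^T :&: kermx (\matrix_(i, j) ((i == j) && (i \in S))%:R))%MS.

Lemma sub_vanish_mxP (F : finFieldType) b n (H : 'M[F]_(b, n)) (S : {set 'I_n}) (w : 'rV[F]_n) :
  reflect (w *m H^T = 0 /\ forall i, i \in S -> w 0 i = 0)
    (w <= vanish_mx H S)%MS.
Proof.
have selE j : (w *m \matrix_(i, j) ((i == j) && (i \in S))%:R) 0 j
    = if j \in S then w 0 j else 0.
  rewrite mxE (bigD1 j) //= mxE eqxx big1 ?addr0 => [|i /negPf ne].
    by case: (j \in S); rewrite ?mulr1 ?mulr0.
  by rewrite mxE ne mulr0.
rewrite sub_capmx; apply: (iffP andP) => [[/sub_kermxP w1 /sub_kermxP w2]|[w1 w2]].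
  split=> // i iS; have := selE i; rewrite iS w2 mxE => <- //.
split; apply/sub_kermxP => //; apply/rowP => j; rewrite selE mxE.
by case: ifP => // /w2.
Qed.

(** Rank-nullity on the words supported off [S]: there the [b] parities have rank [b] minus the
    dimension of their relations. *)
Lemma rank_vanish_mx (F : finFieldType) b n (H : 'M[F]_(b, n)) (S : {set 'I_n}) :
  (\rank (vanish_mx H S) + (b - \rank (kermx (H *m (coord_mx F (~: S))^T)))
     <= #|~: S|)%N.
Proof.
set D := coord_mx F (~: S).
have sZ : (vanish_mx H S <= D :&: kermx H^T)%MS.
  apply/row_subP => i; have /sub_vanish_mxP[w1 w2] := row_sub i (vanish_mx H S).
  rewrite sub_capmx; apply/andP; split; last exact/sub_kermxP.
  by apply: sub_coord_mx => j; rewrite inE negbK; apply: w2.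
have := mxrank_mul_ker D H^T; have := mxrankS sZ; have := rank_leq_row D.
have -> : \rank (D *m H^T) = \rank (H *m D^T) by rewrite -mxrank_tr trmx_mul trmxK.
by rewrite mxrank_ker; have := rank_leq_row (H *m D^T); lia.
Qed.

Lemma vanish_mxS (F : finFieldType) b n (H : 'M[F]_(b, n)) (S T : {set 'I_n}) :
  S \subset T -> (vanish_mx H T <= vanish_mx H S)%MS.
Proof.
move=> /subsetP sST; apply/row_subP => i.
have /sub_vanish_mxP[w1 w2] := row_sub i (vanish_mx H T).
by apply/sub_vanish_mxP; split=> // j /sST/w2.
Qed.

(** Greedy choice: as long as the rank has not dropped enough, some word vanishing on the chosen
    coordinates is nonzero at a coordinate of [S], and adding that coordinate lowers the rank. *)
Lemma independent_coords (F : finFieldType) b n (H : 'M[F]_(b, n)) (S : {set 'I_n}) k :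
  (0 < #|S|)%N -> (\rank (vanish_mx H S) + k <= \rank (kermx H^T))%N ->
  exists t : k.-tuple 'I_n, {subset t <= S} /\
    (\rank (vanish_mx H [set i in t]) + k <= \rank (kermx H^T))%N.
Proof.
case/card_gt0P=> i0 i0S; elim: k => [|k IHk] rkS.
  exists [tuple]; split=> //; rewrite addn0; exact/mxrankS/capmxSl.
have [|t [tS rkt]] := IHk; first by apply: leq_trans rkS; rewrite leq_add2l.
have sub_cons i : (vanish_mx H [set j in i :: t] <= vanish_mx H [set j in t])%MS.
  by apply: vanish_mxS; apply/subsetP => j; rewrite !inE => ->; rewrite orbT.
have [le_rk|] := leqP (\rank (vanish_mx H [set i in t]) + k.+1) (\rank (kermx H^T)).
  (* The rank is already small enough; [i0] only pads the tuple. *)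
  exists [tuple of i0 :: t]; split=> [i|].
    by rewrite inE => /predU1P[->|/tS].
  by apply: leq_trans le_rk; rewrite leq_add2r mxrankS //; apply: sub_cons.
move=> gt_rk; have nsub : ~~ (vanish_mx H [set i in t] <= vanish_mx H S)%MS.
  by apply/negP => /mxrankS; lia.
case/row_subPn: nsub => x; set w := row x _ => nwS.
have wt : (w <= vanish_mx H [set i in t])%MS by exact: row_sub.
have /sub_vanish_mxP[w1 w2] := wt.
case: (pickP [pred i in S | w 0 i != 0]) => [i /andP[iS wi]|none]; last first.
  case/negP: nwS; apply/sub_vanish_mxP; split=> // i iS.
  by have := none i; rewrite /= iS => /negbFE/eqP.
exists [tuple of i :: t]; split=> [j|]; first by rewrite inE => /predU1P[->|/tS].
have : (\rank (vanish_mx H [set j in i :: t]) < \rank (vanish_mx H [set j in t]))%N.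
  apply: rank_ltmx; rewrite ltmxE sub_cons /=; apply/negP => /(submx_trans wt).
  case/sub_vanish_mxP => _ /(_ i); rewrite !inE eqxx => /(_ isT) /eqP.
  by rewrite (negPf wi).
move=> lt_rk; rewrite addnS -addSn; apply: leq_trans rkt; rewrite leq_add2r; exact: lt_rk.
Qed.

(** * Counting coordinates and the sizes of stars *)

(* The pair (u, u) stands for the pendant edge at u. *)
Definition coords (R b : nat) : {set 'I_b * 'I_b} :=
  [set p : 'I_b * 'I_b | (p.1 <= p.2)%N && ((p.1 == p.2) || adj R p.1 p.2)].

Lemma sum_ord_back_adj R b (w : 'I_b) : (0 < R)%N ->
  (\sum_(u < b) ((u < w) && adj R u w) = back_deg R w)%N.
Proof.
move=> R_gt0; rewrite -(sum_back_adj w R_gt0).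
rewrite (big_ord_widen b (fun u => adj R u w : nat) (ltnW (ltn_ord w))).
by rewrite [RHS]big_mkcond; apply: eq_bigr => u _; case: ltnP.
Qed.

Lemma sum_coords_ge R b m : (0 < R)%N -> (m <= b)%N ->
  (\sum_(u < b) \sum_(w < b) ((m <= w) && ((u < w) && adj R u w))
     + turan R m = turan R b)%N.
Proof.
move=> R_gt0 le_mb; rewrite exchange_big /= /turan.
rewrite (big_ord_widen b (back_deg R) le_mb) [X in (_ + X)%N]big_mkcond -big_split.
apply: eq_bigr => w _ /=; rewrite -(sum_ord_back_adj w R_gt0).
case: leqP => [_|_]; first by rewrite addn0.
by rewrite big1 // add0n.
Qed.

Lemma card_coords R b : (0 < R)%N -> #|coords R b| = (b + turan R b)%N.
Proof.
move=> R_gt0; rewrite -sum1_card big_mkcond /=.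
transitivity (\sum_u \sum_w if (u, w) \in coords R b then 1 else 0)%N.
  by rewrite pair_big; apply: eq_bigr => -[].
rewrite -(sum_coords_ge R_gt0 (leq0n b)) turan0 addn0.
transitivity (\sum_(u < b) 1 +
    \sum_(u < b) \sum_(w < b) [&& 0 <= w, u < w & adj R u w])%N; last first.
  by rewrite sum1_card card_ord.
rewrite -big_split /=.
apply: eq_bigr => u _; rewrite (bigD1 u) //= inE leqnn eqxx /= [in RHS](bigD1 u) //= ltnn add0n.
congr addn; apply: eq_bigr => w ne; rewrite inE /= [u == w]eq_sym (negPf ne) /=.
by rewrite ltn_neqAle [u == w :> nat]eq_sym ne /=; case: (_ && _).
Qed.

Lemma card_star R s (v : 'I_(s * R)) : (0 < R)%N -> 
  (\sum_(u < s * R) ((u == v) + adj R v u) = (s * R - s).+1)%N.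
Proof.
move=> R_gt0; rewrite big_split /= (bigD1 v) //= eqxx big1 => [|u /negPf-> //].
rewrite addn0 add1n; congr S; have cE := count_residue_all s (ltn_pmod v R_gt0).
have : (\sum_(u < s * R) ((u %% R == v %% R) + adj R v u) = s * R)%N.
  rewrite -[RHS]card_ord -sum1_card; apply: eq_bigr => u _.
  by rewrite /adj eq_sym; case: (_ == _).
by rewrite big_split /= cE => E; rewrite -[in RHS]E addKn.
Qed.

Lemma card_row_parity_mx (F : finFieldType) R s n (ends : 'I_n -> 'I_(s * R) * 'I_(s * R)) v :
  (0 < R)%N -> injective ends -> (forall i, ends i \in coords R (s * R)) ->
  (#|word_supp (row v (parity_mx F ends))| <= (s * R - s).+1)%N.
Proof.
move=> R_gt0 ends_inj ends_ok; rewrite -(card_star v R_gt0).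
pose Q u w := ((u, w) \in coords R (s * R)) && ((u == v) || (w == v)).
apply: (@leq_trans #|[set i | Q (ends i).1 (ends i).2]|).
  apply/subset_leq_card/subsetP => i; rewrite !inE !mxE /Q -surjective_pairing ends_ok /=.
  rewrite ![_ == v]eq_sym; case: (v == (ends i).1) => //; case: (v == (ends i).2) => //.
  by rewrite subrr eqxx.
apply: leq_trans (card_preim_le Q ends_inj) _.
(* Split by the position of [v]: as lower end, including its pendant edge, or as upper end. *)
apply: (@leq_trans (\sum_(u < s * R) \sum_(w < s * R) ((u == v) * ((v <= w) && ((v == w) || adj R v w))
                    + (w == v) * ((u < v) && adj R v u)))%N).
  apply: leq_sum => u _; apply: leq_sum => w _; rewrite /Q inE /=.
  case: (eqVneq u v) => [->|uv] /=; first by rewrite andbT mul1n leq_addr.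
  case: (eqVneq w v) => [->|wv] /=; last by rewrite andbF.
  by rewrite andbT add0n mul1n (negPf uv) /= adjC ltn_neqAle -[_ != _ :> nat]/(u != v) uv.
under eq_bigr do rewrite big_split /=.
rewrite big_split /= (bigD1 v) //= eqxx [X in (_ + X + _)%N]big1 => [|u /negPf->]; last first.
  by rewrite big1.
rewrite exchange_big /= [X in (_ + _ + X)%N](bigD1 v) //= eqxx.
rewrite [X in (_ + _ + (_ + X))%N]big1 => [|u /negPf->]; last by rewrite big1.
rewrite !addn0 -big_split /=; apply: leq_sum => u _; rewrite !mul1n [u == v]eq_sym.
case: (eqVneq v u) => [<-|vu] /=; first by rewrite ltnn leqnn /adj eqxx.
by case: ltngtP => //=; rewrite ?addn0.
Qed.

(** * Selecting subsets, words and minima *)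

Lemma exists_subset_between (T : finType) (A B : {set T}) m :
  A \subset B -> (#|A| <= m <= #|B|)%N ->
  exists2 S : {set T}, A \subset S & S \subset B /\ #|S| = m.
Proof.
move=> sAB; elim: m => [|m IHm] /andP[leA leB].
  exists A => //; split=> //; apply/eqP; by rewrite -leqn0.
move: leA; rewrite leq_eqVlt => /orP[/eqP<-|]; first by exists A.
rewrite ltnS => leA; have [|S sAS [sSB cS]] := IHm; first by rewrite leA ltnW.
have /subsetPn[x xB xS] : ~~ (B \subset S).
  by apply/negP => /subset_leq_card; rewrite cS leqNgt leB.
exists (x |: S); first exact: subset_trans sAS (subsetUr _ _).
by rewrite cardsU1 xS cS add1n; split=> //; rewrite subUset sub1set xB.
Qed.

Lemma exists_vanishing (F : finFieldType) k n (C : 'M[F]_(k, n)) (T : {set 'I_n}) :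
  (#|T| < k)%N ->
  exists2 x : 'rV_k, x != 0 & forall i, i \in T -> (x *m C) 0 i = 0.
Proof.
move=> ltTk; have : kermx (C *m (coord_mx F T)^T) != 0.
  rewrite -mxrank_eq0 mxrank_ker; have := rank_leq_col (C *m (coord_mx F T)^T).
  by rewrite subn_eq0 -ltnNge => /leq_ltn_trans->.
case/rowV0Pn=> x /sub_kermxP; rewrite mulmxA => xC0 nz_x; exists x => // i iT.
have := congr1 (fun M : 'rV_ _ => M 0 (enum_rank_in iT i)) xC0.
by rewrite mul_tr_coord_mxE enum_rankK_in // => ->; rewrite mxE.
Qed.

Lemma leq_bigmin (I : finType) (P : pred I) (E : I -> nat) n d :
  (d <= n)%N -> (forall i, P i -> d <= E i)%N ->
  (d <= \big[minn/n]_(i | P i) E i)%N.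
Proof.
move=> le_dn le_dE; elim/big_rec: _ => // i x Pi le_dx.
by rewrite leq_min le_dE.
Qed.

Lemma bigmin_leq (I : finType) (P : pred I) (E : I -> nat) n i :
  P i -> (\big[minn/n]_(j | P j) E j <= E i)%N.
Proof.
move=> Pi; rewrite unlock; have := mem_index_enum i.
elim: (index_enum I) => //= j s IHs; rewrite inE => /predU1P[<-|/IHs le_s].
  by rewrite Pi geq_minl.
by case: ifP => // _; rewrite geq_min le_s orbT.
Qed.

(** * Local reconstruction from the stars *)

Lemma parity_mx_pendant (F : finFieldType) b n (ends : 'I_n -> 'I_b * 'I_b) u i :
  ends i = (u, u) -> parity_mx F ends u i = 1.
Proof. by move=> E; rewrite mxE E eqxx andbF subr0. Qed.

Lemma parity_mx_neq0 (F : finFieldType) b n (ends : 'I_n -> 'I_b * 'I_b) v i :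
  (parity_mx F ends v i != 0) = (v == (ends i).1) || (v == (ends i).2).
Proof.
rewrite mxE; case: (eqVneq v (ends i).1) => [->|ne] /=.
  by rewrite andbN subr0 oner_eq0.
case: (eqVneq v (ends i).2) => [E|_] /=; last by rewrite subrr eqxx.
by rewrite -E [_ == v]eq_sym ne sub0r oppr_eq0 oner_eq0.
Qed.

(** Distinct edges have distinct sets of ends, so some vertex lies on exactly one of them. Its star
    repairs that edge first, and any star through the other edge repairs the second. *)
Lemma locally_2_reconstructible_parity (F : finFieldType) R s n
    (ends : 'I_n -> 'I_(s * R) * 'I_(s * R)) (C : {vspace 'rV[F]_n}) :
  (0 < R)%N -> injective ends -> (forall i, ends i \in coords R (s * R)) ->
  (forall c, c \in C -> c *m (parity_mx F ends)^T = 0) ->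
  locally_2_reconstructible (s * R - s) C.
Proof.
move=> R_gt0 ends_inj ends_ok CH.
have lp v : local_parity (s * R - s) C (row v (parity_mx F ends)).
  split; last exact: card_row_parity_mx.
  rewrite inE; apply/forallP => c; apply/implyP => /CH cH.
  have cHv : (c *m (parity_mx F ends)^T) 0 v = 0 by rewrite cH mxE.
  apply/eqP; rewrite -[RHS]cHv [RHS]mxE; apply: eq_bigr => i _.
  by rewrite [row _ _ _ _]mxE [(parity_mx F ends)^T _ _]mxE mulrC.
have suppE v i : (i \in word_supp (row v (parity_mx F ends)))
    = ((v == (ends i).1) || (v == (ends i).2)).
  by rewrite inE [row _ _ _ _]mxE parity_mx_neq0.
have repair i j v : (v == (ends i).1) || (v == (ends i).2) ->
    ~~ ((v == (ends j).1) || (v == (ends j).2)) -> repairs_in_order (s * R - s) C i j.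
  move=> vi vj; split; first by exists (row v (parity_mx F ends)); rewrite !suppE.
  by exists (row (ends j).1 (parity_mx F ends)); rewrite suppE eqxx.
have split_pair i j : i != j -> exists v,
    ((v == (ends i).1) || (v == (ends i).2)) != ((v == (ends j).1) || (v == (ends j).2)).
  move=> ne_ij; apply/existsP; apply: contraNT ne_ij; rewrite negb_exists => /forallP same.
  apply/eqP/ends_inj; have := ends_ok i; have := ends_ok j; rewrite !inE.
  have sameP v := negbNE (same v).
  have := sameP (ends i).1; have := sameP (ends i).2.
  have := sameP (ends j).1; have := sameP (ends j).2.
  case: (ends i) (ends j) => [a1 a2] [c1 c2] /=; rewrite !eqxx ?orbT /= -!val_eqE /=.
  move=> e1 e2 e3 e4 /andP[le_c _] /andP[le_a _].
  by congr (_, _); apply: val_inj => /=; lia.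
move=> i j /split_pair[v]; case: (boolP (_ || _)) => vi; case: (boolP (_ || _)) => vj // _.
  by left; apply: repair vi vj.
by right; apply: repair vj vi.
Qed.

(** * The generic code and its minimum distance *)

(* By duality it suffices that at most #|S| - k independent parities are
   supported in S. *)
Lemma rank_vanish_parity_mx (F : finFieldType) R b n (ends : 'I_n -> 'I_b * 'I_b)
    k l (S : {set 'I_n}) :
  (0 < R)%N -> injective ends -> (forall i, ends i \in coords R b) ->
  n = (b + turan R b)%N -> (l < b)%N ->
  (k + turan R (b - l.+1) <= turan R b)%N -> (k + l <= #|S|)%N ->
  (\rank (vanish_mx (parity_mx F ends) S) + k
     <= \rank (kermx (parity_mx F ends)^T))%N.
Proof.
move=> R_gt0 ends_inj ends_ok nE lt_lb le_k leS; set H := parity_mx F ends.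
have ends_ok' i : ((ends i).1 <= (ends i).2)%N &&
    (((ends i).1 == (ends i).2) || adj R (ends i).1 (ends i).2).
  by have := ends_ok i; rewrite inE.
have := rank_vanish_mx H S; have := @card_uncovered_le F R b n ends (~: S) R_gt0 ends_inj ends_ok'.
rewrite -/H /=; set j := \rank (kermx (H *m _)) => le_unc le_rk.
have le_jb : (j <= b)%N by exact: rank_leq_row.
have cS : (#|S| + #|~: S| = n)%N by rewrite cardsC card_ord.
have le_W : (n <= \rank (kermx H^T) + b)%N.
  by rewrite mxrank_ker mxrank_tr; have := rank_leq_row H; lia.
have rank_arith z w t t' sS cS' j' : (z + (b - j') <= cS')%N -> (j' <= b)%N ->
    (sS + cS' = n)%N -> (n <= w + b)%N -> (k + l <= sS)%N -> (cS' <= t + (b - j'))%N ->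
    (k + t' <= turan R b)%N -> (l < j' -> t <= t')%N -> (z + k <= w)%N.
  (* With at most [l] relations, the [l] coordinates beyond [k] compensate for them. With more, the
     edge bound gives z <= t <= t' <= turan R b - k, while w >= turan R b. *)
  by case: (leqP j' l) => [|lt_lj] *; lia.
apply: (rank_arith _ _ _ _ _ _ _ le_rk le_jb cS le_W leS le_unc le_k) => lt_lj.
by apply: leq_turan; rewrite leq_sub2l.
Qed.

(** There are n^k < q tuples of [k] coordinates, so the code can avoid the vanishing spaces of all
    independent ones, and any [d] coordinates contain such a tuple. *)
Lemma exists_generic_code (F : finFieldType) b n (H : 'M[F]_(b, n)) k d :
  (0 < k)%N -> (k <= d <= n)%N -> (n ^ k < #|F|)%N ->
  (forall S : {set 'I_n}, (d <= #|S|)%N ->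
     (\rank (vanish_mx H S) + k <= \rank (kermx H^T))%N) ->
  exists2 C : 'M[F]_(k, n), C *m H^T = 0 &
    forall (x : 'rV_k) (S : {set 'I_n}), (d <= #|S|)%N ->
      (forall i, i \in S -> (x *m C) 0 i = 0) -> x = 0.
Proof.
move=> k_gt0 /andP[le_kd le_dn] ltF rkS.
pose good (t : k.-tuple 'I_n) :=
  (\rank (vanish_mx H [set i in t]) + k <= \rank (kermx H^T))%N.
(* Dependent tuples get the zero space, which meets the codimension requirement. *)
pose Z t := if good t then vanish_mx H [set i in t] else 0.
have [|t|C sCW hC] := @generic_subspace F n n k (k.-tuple 'I_n) (kermx H^T) Z.
- by rewrite card_tuple card_ord ltF andbT expn_gt0; apply/orP; left; lia.
- rewrite /Z; case: ifP => // _; rewrite mxrank0.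
  by have := rkS setT; rewrite cardsT card_ord => /(_ le_dn); lia.
exists C => [|x S leS xS]; first exact/sub_kermxP.
have [||t [tS rkt]] := @independent_coords F b n H S k; first lia.
  exact: rkS.
apply: (hC t); rewrite /Z /good rkt; apply/sub_vanish_mxP.
split; first by rewrite -mulmxA (sub_kermxP sCW) mulmx0.
by move=> i; rewrite inE => /tS/xS.
Qed.

(** Codewords agree exactly at the zeros of their difference: a nonzero difference has fewer than
    [d] of them, and the given word has at least d - 1. *)
Lemma min_distP (F : finFieldType) k n (C : 'M[F]_(k, n)) (V : {vspace 'rV[F]_n}) d :
  (forall w, reflect (exists x, w = x *m C) (w \in V)) ->
  (0 < d <= n)%N ->
  (forall (x : 'rV_k) (S : {set 'I_n}), (d <= #|S|)%N ->
      (forall i, i \in S -> (x *m C) 0 i = 0) -> x = 0) ->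
  (exists2 x : 'rV_k, x != 0 &
     exists2 S : {set 'I_n}, (d.-1 <= #|S|)%N & forall i, i \in S -> (x *m C) 0 i = 0) ->
  (min_dist V + d)%N = n.+1.
Proof.
move=> VP /andP[d_gt0 le_dn] lower [x nz_x [S leS xS]].
pose zeros (w : 'rV[F]_n) := [set i | w 0 i == 0].
have distE (w w' : 'rV[F]_n) :
    (hamming_dist w w' + #|zeros (w - w')%R|)%N = n.
  rewrite -[RHS](card_ord n) -(cardsC [set i : 'I_n | w 0 i != w' 0 i]) /hamming_dist.
  by congr addn; apply: eq_card => i; rewrite !inE negbK !mxE subr_eq0.
have nz_xC : x *m C != 0.
  apply: contra_neq nz_x => xC0; apply: (lower x setT); first by rewrite cardsT card_ord.
  by move=> i _; rewrite xC0 mxE.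
have ge_d : (n.+1 - d <= min_dist V)%N.
  (* The default value [n] respects the bound because [d] is positive. *)
  apply: leq_bigmin => [|[w w'] /and3P[/= /VP[y ->] /VP[z ->] ne]]; first lia.
  have := distE (y *m C) (z *m C); set S0 := zeros _ => eS0.
  have [ltS0|leS0] := ltnP #|S0| d; first lia.
  case/negP: ne; rewrite -subr_eq0 -mulmxBl (lower (y - z) S0) ?mul0mx //.
  by move=> i; rewrite inE mulmxBl => /eqP.
have : (min_dist V <= hamming_dist (x *m C) 0%R)%N.
  apply: (@bigmin_leq _ _ (fun p : 'rV[F]_n * 'rV[F]_n => hamming_dist p.1 p.2) n (x *m C, 0%R)).
  by rewrite /= mem0v nz_xC andbT; apply/andP; split=> //; apply/VP; exists x.
have : (#|S| <= #|zeros (x *m C - 0)%R|)%N.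
  by apply/subset_leq_card/subsetP => i /xS; rewrite inE subr0 => ->.
have dist_arith m h z c : (h + z = n)%N -> (c <= z)%N -> (m <= h)%N -> (n.+1 - d <= m)%N ->
  (d.-1 <= c)%N -> (m + d)%N = n.+1 by lia.
by move=> le_S le_min; apply: dist_arith (distE _ _) le_S le_min ge_d leS.
Qed.

(** The second [turan] inequality gives the rank condition behind the lower bound. The first says
    that fewer than [k] edges of the graph meet the last [l] vertices, so a nonzero codeword can
    vanish on all of them, and then on the [l] pendant edges too. *)
Lemma exists_code (F : finFieldType) R s k l :
  let b := (s * R)%N in let n := #|coords R b| in
  (0 < R)%N -> (0 < k)%N -> (l < b)%N ->
  (turan R b < k + turan R (b - l))%N ->
  (k + turan R (b - l.+1) <= turan R b)%N ->
  (n ^ k < #|F|)%N ->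
  exists C : {vspace 'rV[F]_n},
    [/\ \dim C = k, locally_2_reconstructible (b - s) C
      & (min_dist C + (k + l) = n.+1)%N].
Proof.
move=> b n R_gt0 k_gt0 lt_lb gt_k le_k ltF.
pose ends (i : 'I_n) : 'I_b * 'I_b := enum_val i.
have ends_inj : injective ends by exact: enum_val_inj.
have ends_ok i : ends i \in coords R b by exact: enum_valP.
have nE : n = (b + turan R b)%N by exact: card_coords.
have le_n : (k + l <= n)%N by lia.
have [||||C CH Clow] := @exists_generic_code F b n (parity_mx F ends) k (k + l) => //.
- by rewrite leq_addr.
- by move=> S leS; apply: (@rank_vanish_parity_mx F R b n ends k l S).
pose V : {vspace 'rV[F]_n} := limg (linfun (mulmxr C)).
have VP w : reflect (exists x, w = x *m C) (w \in V).
  apply: (iffP memv_imgP) => [[x _ ->]|[x ->]]; exists x; rewrite ?memvf ?lfunE //.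
exists V; split.
- rewrite limg_dim_eq ?dimvf /dim /= ?mul1n //.
  apply/eqP; rewrite capfv; apply/eqP/vspaceP => x; rewrite memv_ker memv0 lfunE /=.
  apply/eqP/eqP => [xC0|->]; last by rewrite mul0mx.
  by apply: (Clow x setT); [rewrite cardsT card_ord | move=> i _; rewrite xC0 mxE].
- apply: (@locally_2_reconstructible_parity F R s n ends) => // c /VP[x ->].
  by rewrite -mulmxA CH mulmx0.
apply: (min_distP VP) => //; first by rewrite le_n; lia.
(* [A] holds the graph edges meeting the last [l] vertices, [B] the pendant edges there. *)
pose A := [set i | ((ends i).1 != (ends i).2) && (b - l <= (ends i).2)%N].
pose B := [set i | ((ends i).1 == (ends i).2) && (b - l <= (ends i).2)%N].
have leA : (#|A| + turan R (b - l) <= turan R b)%N.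
  rewrite -(sum_coords_ge R_gt0 (leq_subr l b)) leq_add2r.
  pose Q (u w : 'I_b) := (b - l <= w)%N && ((u < w)%N && adj R u w).
  apply: leq_trans (card_preim_le Q ends_inj).
  apply/subset_leq_card/subsetP => i; rewrite !inE /Q => /andP[ne ->] /=.
  have := ends_ok i; rewrite inE (negPf ne) /= ltn_neqAle => /andP[-> ->].
  by rewrite !andbT; exact: ne.
have cB : #|B| = l.
  rewrite -(card_imset _ ends_inj).
  have -> : ends @: B = [set (u, u) | u : 'I_b & (b - l <= u)%N].
    apply/setP => p; apply/imsetP/imsetP => [[i]|[u]]; rewrite inE.
      move=> /andP[/eqP e1 le_i] ->; exists (ends i).2; first by rewrite inE.
      by rewrite {1}[ends i]surjective_pairing e1.
    move=> le_u ->; have uC : (u, u) \in coords R b by rewrite inE leqnn eqxx.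
    by exists (enum_rank_in uC (u, u)); rewrite ?inE /ends enum_rankK_in ?eqxx.
  rewrite card_imset => [|u u' []//]; rewrite -sum1_card.
  have cE : (b - l + \sum_(u < b | ~~ (u < b - l)) 1 = b)%N.
    rewrite -[RHS]card_ord -[RHS]sum1_card [RHS](bigID (fun u : 'I_b => u < b - l)%N) /=.
    by congr addn; rewrite -[LHS]card_ord -sum1_card (big_ord_widen b (fun=> 1%N) (leq_subr l b)).
  rewrite (eq_bigl (fun u : 'I_b => ~~ (u < b - l)%N)) => [|u]; last by rewrite inE leqNgt.
  apply/eqP; rewrite -(eqn_add2l (b - l)) cE subnK // ltnW //.
have [||T sAT [sTB cT]] := @exists_subset_between _ A (~: B) k.-1.
- apply/subsetP => i; rewrite !inE => /andP[/negPf-> _] //.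
- by have := cardsC B; rewrite cB card_ord; lia.
have [|x nz_x xT] := @exists_vanishing F k n C T; first by rewrite cT prednK.
exists x => //; exists (T :|: B).
  rewrite cardsU cB cT (_ : T :&: B = set0) ?cards0; first lia.
  by apply/eqP; rewrite setI_eq0 -[B]setCK disjoints_subset setCK.
have xH : (x *m C) *m (parity_mx F ends)^T = 0 by rewrite -mulmxA CH mulmx0.
move=> i; rewrite in_setU => /orP[/xT//|]; rewrite inE => /andP[/eqP ei le_i].
(* In the star of this vertex every edge but the pendant one lies in [A], so the parity forces the
   pendant coordinate to vanish. *)
have : ((x *m C) *m (parity_mx F ends)^T) 0 (ends i).2 = 0 by rewrite xH mxE.
rewrite mxE (bigD1 i) //= [_^T _ _]mxE parity_mx_pendant ?mulr1; last first.
  by rewrite {1}[ends i]surjective_pairing ei.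
rewrite big1 ?addr0 // => j ne_ji.
have [jT|jT] := boolP (j \in T); first by rewrite xT ?mul0r.
have [|Hj] := boolP (parity_mx F ends (ends i).2 j != 0); last first.
  by rewrite [_^T _ _]mxE (eqP (negPn Hj)) mulr0.
rewrite parity_mx_neq0 => ij; case/negP: jT; apply: (subsetP sAT); rewrite inE.
have := ends_ok j; rewrite inE => /andP[le_j _]; apply/andP; split.
  apply: contra_neq ne_ji => ej; apply: ends_inj.
  rewrite [ends i]surjective_pairing [ends j]surjective_pairing ei ej.
  by move: ij; rewrite ej orbb => /eqP->.
apply: leq_trans le_i _; case/orP: ij => /eqP-> //.
Qed.

(** * Closed form of the recursion for e *)

Lemma ceil_ratio (N c : int) (m x : nat) :
  (x < m)%N -> N = c * m%:Z - x%:Z -> Num.ceil (N%:~R / m%:R : rat) = c.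
Proof.
move=> lt_xm NE; have m_gt0 : (0 < m%:R :> rat) by rewrite ltr0n; lia.
apply: ceil_def; rewrite ltr_pdivlMr // ler_pdivrMr //.
have mE : (m%:R : rat) = (m%:Z)%:~R by [].
rewrite mE -!intrM ltr_int ler_int NE; apply/andP; split; first by nia.
by lia.
Qed.

(** e_j counts the coordinates at the last [j] vertices: [j] pendant edges and the graph edges
    meeting these vertices. By [turan_compl] this equals j (r + 1) - turan R j, the form that suits
    the recursion. *)
Lemma dimension_drops (R s : nat) (e : nat -> int) :
  let b := (s * R)%N in let r := (b - s)%N in
  (1 < R)%N -> (0 < s)%N -> e 0%N = 0 -> e b = (b + turan R b)%:Z ->
  (forall m : nat, (2 <= m <= b)%N ->
     e m.-1 = e m - Num.ceil ((2 * e m)%:~R / m%:R : rat) + (r + 1)%:Z) ->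
  forall j, (j <= b)%N -> e j + (turan R (b - j))%:Z = (j + turan R b)%:Z.
Proof.
move=> b r R_gt1 s_gt0 he0 heb herec j le_jb; have R_gt0 : (0 < R)%N by lia.
have le_sb : (s <= b)%N by rewrite leq_pmulr.
have tb : (turan R b + turan R b = b * r)%N.
  by rewrite (@turan_compl R s b) // subnn turan0 addn0.
(* Induction downwards from [b] to 1, where the recursion ends; index 0 is the convention. *)
suff eE i : (i < b)%N -> e (b - i)%N + (turan R (b - i))%:Z = ((b - i) * r.+1)%:Z.
  case: j le_jb => [|j] le_jb; first by rewrite he0 subn0 add0r.
  have := eE (b - j.+1)%N; rewrite subKn // => /(_ _); have := @turan_compl R s j.+1 le_jb.
  rewrite -/b -/r mulnS; lia.
elim: i => [|i IHi] lt_ib; first by rewrite subn0 heb mulnS; lia.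
have := IHi (ltnW lt_ib); set m := (b - i)%N => em.
have -> : (b - i.+1 = m.-1)%N by rewrite subnS.
have m_ge2 : (2 <= m <= b)%N by rewrite /m; lia.
rewrite herec //.
have m_gt0 : (0 < m)%N by lia.
have dt := double_turan m.-1 R_gt0; rewrite prednK // in dt.
have lt_x : (m.-1 %/ R * (R.-1 - m.-1 %% R) < m)%N.
  apply: leq_ltn_trans (_ : m.-1 < m)%N; last lia.
  apply: leq_trans (leq_trunc_div m.-1 R); rewrite leq_mul2l; apply/orP; right; lia.
(* As the excess is below [m], twice [turan R m] over [m] rounds down to the least degree. *)
rewrite (@ceil_ratio _ (2 * r.+1%:Z - (back_deg R m.-1)%:Z) m _ lt_x).
  have := turanS R m.-1; rewrite prednK // => tm.
  have : (m.-1 * r.+1 + r.+1 = m * r.+1)%N by rewrite -{2}(prednK m_gt0) mulSn addnC.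
  lia.
rewrite (_ : e m = (m * r.+1)%:Z - (turan R m)%:Z); last by rewrite -em addrK.
move: dt; set x := (_ * (_ - _))%N => dt.
have {dt} : 2 * (turan R m)%:Z = m%:Z * (back_deg R m.-1)%:Z + x%:Z.
  by rewrite -PoszM -PoszD -dt PoszM.
by rewrite PoszM mulrBr => ->; ring.
Qed.

(** * Choice of the graph and of l *)

Theorem mainTheorem2 (r beta n k b : nat) (e : nat -> int)
  (hbeta : (1 <= beta <= r)%N)
  (hdvd : (beta %| r)%N)
  (hn : n = ((r + beta) * (r + 2) %/ 2)%N)
  (hk : (1 <= k)%N /\ (k%:R <= (r * n)%:R / (r + 2)%:R :> rat))
  (hb : b = (r + beta)%N)
  (he0 : e 0%N = 0)
  (heb : e b = n%:Z)
  (herec : forall m : nat, (2 <= m <= b)%N ->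
     e m.-1 = e m - Num.ceil ((2 * e m)%:~R / m%:R : rat) + (r + 1)%:Z) :
  exists l : nat,
    unique (fun l : nat =>
      (l <= b - 1)%N /\ (e l < (k + l)%:Z /\ (k + l)%:Z < e l.+1)) l /\
    forall F : finFieldType, (k * n ^ k < #|F|)%N ->
      exists C : {vspace 'rV[F]_n},
        [/\ \dim C = k,
            locally_2_reconstructible r C
          & (min_dist C)%:Z = n%:Z + 1 - (k + l)%:Z].
Proof.
case/andP: hbeta => beta_gt0 le_br; case: hk => k_gt0 hk.
(* With this many classes of size [beta] there are r + beta vertices, each of degree [r]. *)
pose R := (r %/ beta).+1; have R_gt0 : (0 < R)%N by [].
have R_gt1 : (1 < R)%N by rewrite ltnS divn_gt0.
have bE : b = (beta * R)%N by rewrite hb mulnS addnC [(beta * _)%N]mulnC divnK.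
have rE : (beta * R - beta = r)%N by rewrite -bE hb addnK.
have tb : (turan R b + turan R b = b * r)%N.
  by rewrite bE (@turan_compl R beta (beta * R)) // subnn turan0 addn0 rE.
have nE : n = (b + turan R b)%N.
  rewrite hn -hb (_ : (b * (r + 2) = (b + turan R b) * 2)%N) ?mulnK //.
  by rewrite mulnDr -tb; lia.
(* The bound r n / (r + 2) equals b r / 2, the number of edges. *)
have le_k : (k <= turan R b)%N.
  have r2_gt0 : (0 < (r + 2)%:R :> rat) by rewrite ltr0n addn2.
  move: hk; rewrite ler_pdivlMr // -natrM ler_nat => hk.
  have : (r * n * 2 = (r + 2) * (turan R b * 2))%N.
    by rewrite nE -mulnA mulnDl [(turan R b * 2)%N]muln2 -addnn tb; ring.
  move=> rnE; rewrite -(@leq_pmul2r (r + 2)) ?addn2 // -addn2; nia.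
have drop j : (j <= b)%N -> e j + (turan R (b - j))%:Z = (j + turan R b)%:Z.
  rewrite bE; apply: dimension_drops => //; first by rewrite -bE heb nE.
  by move=> m; rewrite rE -bE; apply: herec.
(* [P j] is the inequality k + j < e_(j+1); the least such [j] serves as [l], and minimality gives
   the other inequality. *)
pose P j := (k + turan R (b - j.+1) <= turan R b)%N.
have b_gt0 : (0 < b)%N by rewrite hb addn_gt0 beta_gt0 orbT.
have exP : exists j, P j by exists b.-1; rewrite /P prednK // subnn turan0 addn0.
case: (ex_minnP exP) => l Pl minl.
have lt_lb : (l < b)%N.
  by rewrite -(prednK b_gt0) ltnS; apply: minl; rewrite /P prednK // subnn turan0 addn0.
have gt_k : (turan R b < k + turan R (b - l))%N.
  case: l minl {Pl lt_lb} => [|l] minl; first by rewrite subn0 -[ltnLHS]add0n ltn_add2r.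
  by rewrite ltnNge; apply/negP => /minl; rewrite ltnn.
have condE j : (j <= b - 1)%N ->
    (e j < (k + j)%:Z /\ (k + j)%:Z < e j.+1) <->
    (turan R b < k + turan R (b - j) /\ k + turan R (b - j.+1) <= turan R b)%N.
  move=> le_j; have := drop j; have := drop j.+1.
  have -> : (j.+1 <= b)%N by lia.
  have -> : (j <= b)%N by lia.
  by move=> /(_ isT) e1 /(_ isT) e2; split=> -[]; lia.
exists l; split.
  have le_l : (l <= b - 1)%N by lia.
  split=> [|l' [le_l' /(condE _ le_l') [gt_k' Pl']]]; first by split=> //; apply/(condE _ le_l).
  (* By monotonicity of [turan], the upper inequality at [i] refutes the lower one at every later
     [j]. *)
  have no_lt i j : (i < j)%N -> P i -> ~~ (turan R b < k + turan R (b - j))%N.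
    move=> lt_ij Pi; rewrite -leqNgt; apply: leq_trans Pi.
    by rewrite leq_add2l leq_turan // leq_sub2l.
  case: (ltngtP l l') => // [lt_l|lt_l].
    by have := no_lt _ _ lt_l Pl; rewrite gt_k'.
  by have := no_lt _ _ lt_l Pl'; rewrite gt_k.
move=> F ltF; have cE : n = #|coords R (beta * R)| by rewrite card_coords // -bE.
have ltF' : (n ^ k < #|F|)%N by apply: leq_ltn_trans ltF; rewrite leq_pmull.
rewrite /P bE in lt_lb gt_k Pl; rewrite {}cE in ltF' *.
have [C [dimC recC minC]] := exists_code R_gt0 k_gt0 lt_lb gt_k Pl ltF'.
by exists C; split=> //; [rewrite rE in recC | lia].
Qed.
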